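(* For any computably bounded numbering $\phi$ and any positive integer constant $k$, there is no computable function $f:\mathbb{N}\to\mathbb{N}^k$ such that $\min_\phi(e)$ is one of the $k$ entries of $f(e)$ for all $e$.
   Context: A numbering $\phi$ is given by a partial-recursive function $U:\mathbb{N}^2\to\mathbb{N}$ via $\phi_e(x)=U(e,x)$. $\phi$ is computably bounded if for every numbering $\psi$ there is a computable $f$ such that for every $e$ some $j\le f(e)$ has $\phi_j=\psi_e$. $\mathrm{MIN}_\phi=\{e:(\forall j<e)\,[\phi_j\ne\phi_e]\}$ and $\min_\phi(e)$ is the unique $j\in\mathrm{MIN}_\phi$ with $\phi_j=\phi_e$. *)

(* Defs.v *)
From mathcomp Require Import all_boot.
From mathcomp Require Import boolp.

Set Implicit Arguments.
Unset Strict Implicit.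
Unset Printing Implicit Defensive.

(* Syntax of the (partial) mu-recursive functions, indexed by arity. *)
Inductive murec : nat -> Type :=
| MZero n : murec n
| MSucc : murec 1
| MProj n (i : 'I_n) : murec n
| MComp m n (g : murec m) (h : 'I_m -> murec n) : murec n
| MPrec n (g : murec n) (h : murec n.+2) : murec n.+1
| MMin n (g : murec n.+1) : murec n.

(* Graph of the function r given by r 0 = g and r i.+1 = h i (r i), where the
   partial value g and the partial function h are given by their graphs. *)
Fixpoint prec_graph (g : nat -> Prop) (h : nat -> nat -> nat -> Prop)
    (i y : nat) : Prop :=
  if i is i'.+1 then exists2 z, prec_graph g h i' z & h i' z y else g y.

(* meval c xs y: the partial function denoted by c is defined at xs, with
   value y. Minimization at y requires g to be defined and nonzero at every
   i < y; recursion is on the first argument. *)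
Fixpoint meval n (c : murec n) : n.-tuple nat -> nat -> Prop :=
  match c in murec n return n.-tuple nat -> nat -> Prop with
  | MZero _ => fun _ y => y = 0
  | MSucc => fun xs y => y = (thead xs).+1
  | MProj _ i => fun xs y => y = tnth xs i
  | MComp m _ g h => fun xs y =>
      exists2 zs : m.-tuple nat,
        forall i, meval (h i) xs (tnth zs i) & meval g zs y
  | MPrec _ g h => fun xs y =>
      let ys := behead_tuple xs in
      prec_graph (meval g ys) (fun i z => meval h [tuple of i :: z :: ys])
        (thead xs) y
  | MMin _ g => fun xs y =>
      meval g [tuple of y :: xs] 0 /\
      forall i, i < y -> exists z, meval g [tuple of i :: xs] z.+1
  end.

(* Partial functions are represented by option-valued ones, None meaning
   "undefined". *)
Definition partial_recursive2 (U : nat -> nat -> option nat) : Prop :=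
  exists c : murec 2, forall e x y, U e x = Some y <-> meval c [tuple e; x] y.

Definition computable (f : nat -> nat) : Prop :=
  exists c : murec 1, forall x, meval c [tuple x] (f x).

Definition computable_tuple k (f : nat -> k.-tuple nat) : Prop :=
  forall i, computable (fun x => tnth (f x) i).

(* phi e x is U(e, x), and phi e is the partial function phi_e. *)
Record numbering := Numbering {
  numbering_fun :> nat -> nat -> option nat;
  numbering_partial_recursive : partial_recursive2 numbering_fun
}.

Definition computably_bounded (phi : numbering) : Prop :=
  forall psi : numbering, exists2 f : nat -> nat, computable f &
    forall e, exists2 j, j <= f e & phi j =1 psi e.

Definition MIN (phi : numbering) (e : nat) : Prop :=
  forall j, j < e -> ~ phi j =1 phi e.

Lemma MIN_exists_unique (phi : numbering) (e : nat) :
  exists! j, MIN phi j /\ phi j =1 phi e.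
Proof.
have ex : exists j, `[< phi j =1 phi e >] by exists e; apply/asboolP.
case: (ex_minnP ex) => j /asboolP jE jmin; exists j; split.
  split=> // i ij iE; move: ij; rewrite ltnNge jmin //.
  by apply/asboolP => x; rewrite iE.
move=> i [iM iE]; apply/eqP; rewrite eqn_leq (jmin i) ?andbT; last exact/asboolP.
rewrite leqNgt; apply/negP => ji; apply: (iM _ ji) => x.
by rewrite jE iE.
Qed.

Lemma MIN_exists (phi : numbering) (e : nat) :
  exists j, MIN phi j /\ phi j =1 phi e.
Proof. by have [j [jP _]] := MIN_exists_unique phi e; exists j. Qed.

Definition min_index (phi : numbering) (e : nat) : nat :=
  sval (cid (MIN_exists phi e)).

Lemma min_indexP (phi : numbering) (e : nat) :
  MIN phi (min_index phi e) /\ phi (min_index phi e) =1 phi e.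
Proof. exact: (svalP (cid (MIN_exists phi e))). Qed.

(* Main.v *)
(* A computably bounded numbering [phi] contains every computable function, so
   it is itself universal and no further coding of programs is needed. If
   [min_index phi (h b) > b] for a computable [h], the numbering
   [psi e := phi (h (phi e e))] violates the bound [g] that computable
   boundedness gives for it: at an index [c] of [g], the function [psi c] has
   minimal index greater than [g c].
   Let [f e] be a [k]-tuple containing [min_index phi e]. By induction on [r]
   there are a finite function [sigma] and a [b] such that every [phi e]
   extending [sigma] has minimal index greater than [b] while at least [r]
   entries of [f e] are at most [b]. For the step, if each [b'] admits an [e]
   extending [sigma] with at most [r] entries of [f e] below [b'], such an [e]
   can be searched for effectively; its minimal index is an entry of [f e]
   that lies above [b'], which yields a forbidden [h]. Otherwise some [b']
   works after extending [sigma] away from [phi 0, ..., phi b']. At [r = k] no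
   entry of [f e] is left for the minimal index. *)
Require Import Defs.
From mathcomp Require Import all_boot.
From mathcomp Require Import boolp.

Set Implicit Arguments.
Unset Strict Implicit.
Unset Printing Implicit Defensive.

(** * Closure properties of partial and total recursive functions *)

(* Environments are plain sequences; [R] only matters on those of size [n]. *)
Definition partrec n (R : seq nat -> nat -> Prop) : Prop :=
  exists c : murec n, forall (xs : n.-tuple nat) y, meval c xs y <-> R xs y.

Definition totrec n (F : seq nat -> nat) : Prop := partrec n (fun xs y => y = F xs).

Definition totrecs n m (G : seq nat -> seq nat) : Prop :=
  (forall xs, size xs = n -> size (G xs) = m) /\
  forall i, i < m -> totrec n (fun xs => nth 0 (G xs) i).

Lemma eq_partrec n R S :
  (forall xs y, size xs = n -> R xs y <-> S xs y) -> partrec n R -> partrec n S.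
Proof.
move=> RS [c cP]; exists c => xs y.
by rewrite cP; apply: RS; rewrite size_tuple.
Qed.

Lemma eq_totrec n F G :
  (forall xs, size xs = n -> F xs = G xs) -> totrec n F -> totrec n G.
Proof. by move=> FG; apply: eq_partrec => xs y /FG ->. Qed.

Lemma partrec_subst m n R G :
  partrec m R -> totrecs n m G -> partrec n (fun xs => R (G xs)).
Proof.
move=> [c cP] [sG GP].
have /choice [h hP] (i : 'I_m) : exists d : murec n,
    forall (xs : n.-tuple nat) y, meval d xs y <-> y = nth 0 (G xs) i.
  by case: (GP i (ltn_ord i)) => d dP; exists d.
exists (MComp c h) => xs y /=.
have sGxs : size (G xs) == m by rewrite sG ?size_tuple.
have GE (i : 'I_m) : tnth (Tuple sGxs) i = nth 0 (G xs) i by rewrite (tnth_nth 0).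
split=> [[zs zsP] /cP|RG].
  suff -> : tval zs = G xs by [].
  apply: (@eq_from_nth _ 0); first by rewrite size_tuple (eqP sGxs).
  move=> i; rewrite size_tuple => im.
  by have /hP := zsP (Ordinal im); rewrite (tnth_nth 0).
exists (Tuple sGxs); last exact/cP.
by move=> i; apply/hP; rewrite GE.
Qed.

Lemma totrec_subst m n F G : totrec m F -> totrecs n m G -> totrec n (F \o G).
Proof. exact: partrec_subst. Qed.

Lemma totrec_nth n i : totrec n (nth 0 ^~ i).
Proof.
have [lt_in|le_ni] := ltnP i n.
  by exists (MProj (Ordinal lt_in)) => xs y /=; rewrite (tnth_nth 0).
(* Past the end, [nth] returns its default [0], so the zero function serves. *)
by exists (MZero n) => xs y /=; rewrite nth_default ?size_tuple.
Qed.

Lemma totrecs_drop k n : totrecs (k + n) n (drop k).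
Proof.
split=> [xs|i _]; first by rewrite size_drop => ->; rewrite addKn.
by apply: eq_totrec (totrec_nth _ (k + i)) => xs _; rewrite nth_drop.
Qed.

Lemma totrecs_id n : totrecs n n id.
Proof. by split=> // i _; apply: totrec_nth. Qed.

Lemma totrecs_nil n : totrecs n 0 (fun=> [::]).
Proof. by []. Qed.

Lemma totrecs_cons n m F G :
  totrec n F -> totrecs n m G -> totrecs n m.+1 (fun xs => F xs :: G xs).
Proof.
move=> FP [sG GP]; split=> [xs /sG /= -> //|[|i] im]; first exact: FP.
exact: (GP i).
Qed.

Lemma totrec_succ n F : totrec n F -> totrec n (fun xs => (F xs).+1).
Proof.
move=> FP.
apply: (@totrec_subst 1 n (fun xs => (nth 0 xs 0).+1) (fun xs => [:: F xs])).
  by exists MSucc => xs y /=; rewrite /thead (tnth_nth 0).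
exact: totrecs_cons (totrecs_nil n).
Qed.

Lemma totrec_const n a : totrec n (fun=> a).
Proof.
by elim: a => [|a IH]; [exists (MZero n) | apply: totrec_succ].
Qed.

Lemma meval_prec n (g : murec n) (h : murec n.+2) i (xs : n.-tuple nat) y :
  meval (MPrec g h) [tuple of i :: xs] y <->
  prec_graph (meval g xs) (fun j z => meval h [tuple of [:: j, z & xs]]) i y.
Proof.
set ys := [tuple of i :: xs].
change (prec_graph (meval g (behead_tuple ys))
  (fun j z => meval h [tuple of [:: j, z & behead_tuple ys]]) (thead ys) y <->
  prec_graph (meval g xs) (fun j z => meval h [tuple of [:: j, z & xs]]) i y).
by have -> : behead_tuple ys = xs by apply: val_inj.
Qed.

Lemma totrec_iteri n I A H :
  totrec n I -> totrec n A -> totrec n.+2 H ->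
  totrec n (fun xs => iteri (I xs) (fun i z => H [:: i, z & xs]) (A xs)).
Proof.
move=> IP [a aP] [h hP].
pose F xs := iteri (head 0 xs) (fun i z => H [:: i, z & behead xs]) (A (behead xs)).
suff FP : totrec n.+1 F.
  exact: (totrec_subst FP (totrecs_cons IP (totrecs_id n))).
exists (MPrec a h) => xs y; case/tupleP: xs => i xs.
rewrite meval_prec /F /=.
elim: i y => [|i IH] y /=; first exact: aP.
split=> [[z /IH -> /hP //]|->].
by eexists; [apply/IH | apply/hP].
Qed.

(** Primitive recursion that ignores its accumulator: the last of [i.+1] rounds sees the counter
    [i]. *)
Lemma totrec_case n I A H :
  totrec n I -> totrec n A -> totrec n.+1 H ->
  totrec n (fun xs => if I xs is i.+1 then H (i :: xs) else A xs).
Proof.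
move=> IP AP HP.
have H'P : totrec n.+2 (fun ys => H (nth 0 ys 0 :: drop 2 ys)).
  exact: (totrec_subst HP (totrecs_cons (totrec_nth _ 0) (totrecs_drop 2 n))).
apply: eq_totrec (totrec_iteri IP AP H'P) => xs _.
by case: (I xs) => //= i; rewrite drop0.
Qed.

Lemma totrec_pred n F : totrec n F -> totrec n (fun xs => (F xs).-1).
Proof.
move=> FP; apply: eq_totrec (totrec_case FP (totrec_const n 0) (totrec_nth _ 0)).
by move=> xs _ /=; case: (F xs).
Qed.

Lemma totrec_wk k n F : totrec n F -> totrec (k + n) (F \o drop k).
Proof. by move=> FP; apply: totrec_subst FP (totrecs_drop k n). Qed.

Lemma totrec_add n F G :
  totrec n F -> totrec n G -> totrec n (fun xs => F xs + G xs).
Proof.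
move=> FP GP.
apply: eq_totrec (totrec_iteri FP GP (totrec_succ (totrec_nth _ 1))) => xs _ /=.
by elim: (F xs) => //= i ->.
Qed.

Lemma totrec_sub n F G :
  totrec n F -> totrec n G -> totrec n (fun xs => F xs - G xs).
Proof.
move=> FP GP.
apply: eq_totrec (totrec_iteri GP FP (totrec_pred (totrec_nth _ 1))) => xs _ /=.
by elim: (G xs) => [|i /= ->]; rewrite ?subn0 ?subnS.
Qed.

Lemma totrec_sum (I : Type) (r : seq I) n (F : I -> seq nat -> nat) :
  (forall i, totrec n (F i)) -> totrec n (fun xs => \sum_(i <- r) F i xs).
Proof.
move=> FP; elim: r => [|i r IH].
  by apply: eq_totrec (totrec_const n 0) => xs _; rewrite big_nil.
by apply: eq_totrec (totrec_add (FP i) IH) => xs _; rewrite big_cons.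
Qed.

Lemma totrec_lookup s n F : totrec n F -> totrec n (fun xs => nth 0 s (F xs)).
Proof.
elim: s n F => [|a s IH] n F FP.
  by apply: eq_totrec (totrec_const n 0) => xs _; rewrite nth_nil.
apply: eq_totrec (totrec_case FP (totrec_const n a) (IH _ _ (totrec_nth n.+1 0))).
by move=> xs _; case: (F xs).
Qed.

(** [choice] merely names the least zero; [MMin] computes it, since totality of [F] makes every
    earlier test converge. *)
Lemma totrec_mu n F :
  totrec n.+1 F -> (forall xs, size xs = n -> exists y, F (y :: xs) = 0) ->
  exists2 h, totrec n h & forall xs, size xs = n -> F (h xs :: xs) = 0.
Proof.
move=> [c cP] Fex.
have /choice [h hP] xs : exists y, size xs = n ->
    F (y :: xs) = 0 /\ forall i, i < y -> F (i :: xs) <> 0.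
  have [sx|sx] := pselect (size xs = n); last by exists 0.
  have ex : exists y, F (y :: xs) == 0.
    by have [y yP] := Fex _ sx; exists y; apply/eqP.
  case: (ex_minnP ex) => y /eqP y0 ymin; exists y => _; split=> // i iy /eqP /ymin.
  by rewrite leqNgt iy.
exists h => [|xs sx]; last by case: (hP _ sx).
exists (MMin c) => xs y /=.
have [h0 hlt] := hP _ (size_tuple xs).
have pos i : i < h xs -> exists z, meval c [tuple of i :: xs] z.+1.
  move=> /hlt; case E: (F (i :: xs)) => [|z] // _.
  by exists z; apply/cP => /=; rewrite E.
split=> [[/cP /= y0 yP]|->]; last by split=> //; apply/cP.
case: (ltngtP y (h xs)) => //; first by move=> /hlt; rewrite -y0.
by move=> /yP [z] /cP /=; rewrite h0.
Qed.

(** Here, unlike in [totrec_subst], the inner computation may diverge. Input [0] of the composition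
    is computed by the program of [R]; projections copy [xs] to the others. *)
Lemma partrec_bind n R S :
  partrec n R -> partrec n.+1 S ->
  partrec n (fun xs y => exists2 z, R xs z & S (z :: xs) y).
Proof.
move=> [c cP] [d dP].
pose h (i : 'I_n.+1) : murec n := if unlift ord0 i is Some j then MProj j else c.
exists (MComp d h) => xs y /=.
have h0 z : meval (h ord0) xs z <-> R xs z by rewrite /h unlift_none.
have hS j z : meval (h (lift ord0 j)) xs z <-> z = tnth xs j by rewrite /h liftK.
split=> [[zs zsP] /dP Sy|[z Rz Sy]].
  case/tupleP: zs zsP Sy => z zs zsP Sy.
  exists z; first by apply/h0; have := zsP ord0; rewrite (tnth_nth 0).
  suff -> : xs = zs by [].
  apply: eq_from_tnth => j; have /hS := zsP (lift ord0 j).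
  by rewrite !(tnth_nth 0).
exists [tuple of z :: xs]; last exact/dP.
move=> i; case: (unliftP ord0 i) => [j|] ->.
  by apply/hS; rewrite !(tnth_nth 0).
by apply/h0; rewrite (tnth_nth 0).
Qed.

(** * Step-bounded evaluation of programs *)

(* [T (s :: xs)] is [y.+1] if [c] is found within [s] steps to have value [y]
   at [xs], and [0] otherwise. *)
Definition stages n (c : murec n) (T : seq nat -> nat) : Prop :=
  [/\ totrec n.+1 T,
      forall s t xs y, size xs = n -> s <= t ->
        T (s :: xs) = y.+1 -> T (t :: xs) = y.+1
    & forall (xs : n.-tuple nat) y, meval c xs y <-> exists s, T (s :: xs) = y.+1].

(** The inner programs and [g] all run with the same stage [s]; by monotonicity the maximum of the
    finitely many stages required suffices. *)
Lemma stages_comp m n (g : murec m) (h : 'I_m -> murec n) S U :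
  stages g S -> (forall i, stages (h i) (U i)) -> exists T, stages (MComp g h) T.
Proof.
move=> [Sc Sm SP] UP.
pose V ys := [seq (U i ys).-1 | i <- enum 'I_m].
have sV ys : size (V ys) = m by rewrite size_map size_enum_ord.
have VE ys (i : 'I_m) : nth 0 (V ys) i = (U i ys).-1.
  by rewrite (nth_map i) ?size_enum_ord // nth_ord_enum.
(* The sum counts the inner programs without a value at this stage. *)
pose T ys := if \sum_(i <- enum 'I_m) (1 - U i ys) is _.+1 then 0
  else S (nth 0 ys 0 :: V ys).
have TE ys : (forall i, 0 < U i ys) -> T ys = S (nth 0 ys 0 :: V ys).
  by move=> U0; rewrite /T big1_seq // => i _; apply/eqP; rewrite subn_eq0.
have T0 ys z : T ys = z.+1 -> forall i, 0 < U i ys.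
  rewrite /T => E i; rewrite lt0n; apply/negP => /eqP Ui; move: E.
  by rewrite (bigD1_seq i) ?mem_enum ?enum_uniq //= Ui.
exists T; split.
- apply: (@totrec_case n.+1 _ _ (fun=> 0)); last exact: totrec_const.
    apply: totrec_sum => i; apply: totrec_sub; first exact: totrec_const.
    by case: (UP i).
  apply: (totrec_subst Sc); apply: totrecs_cons; first exact: totrec_nth.
  split=> [//|i im]; have [Uc _ _] := UP (Ordinal im).
  by apply: eq_totrec (totrec_pred Uc) => ys _; rewrite (VE ys (Ordinal im)).
- move=> s t xs y sx st E; have U0 := T0 _ _ E.
  have UE i : U i (t :: xs) = U i (s :: xs).
    have [_ Um _] := UP i; have := U0 i; case Es: (U i (s :: xs)) => [|z] // _.
    exact: Um Es.
  have VV : V (t :: xs) = V (s :: xs) by apply: eq_map => i; rewrite UE.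
  rewrite TE; last by move=> i; rewrite UE.
  by rewrite VV; move: E; rewrite TE //=; apply: Sm.
- move=> xs y /=; split=> [[zs zsP] /SP [s Es]|[s E]].
    have /choice [p pP] (i : 'I_m) : exists s, U i (s :: xs) = (tnth zs i).+1.
      by have [_ _ UPi] := UP i; apply/UPi.
    pose t := maxn s (\max_i p i); exists t.
    have UE i : U i (t :: xs) = (tnth zs i).+1.
      have [_ Um _] := UP i; apply: Um (pP i); first by rewrite size_tuple.
      by rewrite leq_max (leq_bigmax i) orbT.
    rewrite TE; last by move=> i; rewrite UE.
    have -> : V (t :: xs) = zs.
      apply: (@eq_from_nth _ 0); first by rewrite sV size_tuple.
      by move=> i; rewrite sV => im; rewrite (VE _ (Ordinal im)) UE (tnth_nth 0).
    by apply: Sm Es; rewrite ?size_tuple ?leq_maxl.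
  have U0 := T0 _ _ E; move: E; rewrite TE //= => E.
  have sVxs : size (V (s :: xs)) == m by rewrite sV.
  exists (Tuple sVxs); last by apply/SP; exists s.
  move=> i; have [_ _ UPi] := UP i; apply/UPi; exists s.
  by rewrite (tnth_nth 0) /= VE prednK.
Qed.

(** The recursion is rerun with one stage [s] shared by all calls. Its accumulator holds the value
    plus one, and a timeout [0] propagates. *)
Lemma stages_prec n (g : murec n) (h : murec n.+2) S U :
  stages g S -> stages h U -> exists T, stages (MPrec g h) T.
Proof.
move=> [Sc Sm SP] [Uc Um UP].
pose W s xs i := iteri i
  (fun i z => if z is z'.+1 then U [:: s, i, z' & xs] else 0) (S (s :: xs)).
pose T ys := W (nth 0 ys 0) (drop 2 ys) (nth 0 ys 1).
have WS s xs i : W s xs i.+1 = if W s xs i is z.+1 then U [:: s, i, z & xs] else 0.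
  by [].
have Wm s t xs i y : size xs = n -> s <= t -> W s xs i = y.+1 -> W t xs i = y.+1.
  move=> sx st; elim: i y => [|i IH] y; first exact: Sm.
  rewrite !WS; case E: (W s xs i) => [|z] //; rewrite (IH _ E).
  by apply: Um => //=; rewrite sx.
exists T; split.
(* The environment of [H] lists counter, accumulator, stage, recursion argument and parameters. *)
- pose H ys := if nth 0 ys 1 is z.+1 then
    U [:: nth 0 ys 2, nth 0 ys 0, z & drop 4 ys] else 0.
  have HP : totrec n.+4 H.
    apply: (@totrec_case _ _ _
      (fun zs => U [:: nth 0 zs 3, nth 0 zs 1, nth 0 zs 0 & drop 5 zs])).
    + exact: totrec_nth.
    + exact: totrec_const.
    apply: (totrec_subst Uc); do 3 (apply: totrecs_cons; first exact: totrec_nth).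
    exact: (totrecs_drop 5 n).
  have S'c : totrec n.+2 (fun ys => S (nth 0 ys 0 :: drop 2 ys)).
    exact: (totrec_subst Sc (totrecs_cons (totrec_nth _ 0) (totrecs_drop 2 n))).
  apply: eq_totrec (totrec_iteri (totrec_nth _ 1) S'c HP) => ys _.
  by case: ys => [|a [|b [|d ys]]].
- by move=> s t [|i xs] y //= [sx]; rewrite /T /= !drop0; apply: Wm.
- move=> xs y; case/tupleP: xs => i xs; rewrite meval_prec /T /= drop0.
  elim: i y => [|i IH] y; first exact: SP.
  split=> [[z /IH [s Es] /UP [t /= Et]]|[s]]; last rewrite WS.
    exists (maxn s t); rewrite (Wm _ _ _ _ _ _ (leq_maxl s t) Es) ?size_tuple //.
    by apply: Um Et; rewrite ?leq_maxr //= size_tuple.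
  case E: (W s xs i) => [|z] // Ey; exists z; first by apply/IH; exists s.
  by apply/UP; exists s.
Qed.

Lemma stages_min n (g : murec n.+1) S :
  stages g S -> exists T, stages (MMin g) T.
Proof.
move=> [Sc Sm SP].
(* [W s xs j] is the state of the search after testing all [i < j]: [0] if still
   running, [1] if blocked at an undefined value, [y.+2] if [y] is the result. *)
pose W s xs j := iteri j (fun i z => if z is _.+1 then z else
   if S [:: s, i & xs] is v.+1 then (if v is _.+1 then 0 else i.+2) else 1) 0.
(* The stage bounds both the steps of each test and the number of candidates. The predecessor merges
   running and blocked into [0]. *)
pose T ys := (W (nth 0 ys 0) (drop 1 ys) (nth 0 ys 0)).-1.
have WS s xs j : W s xs j.+1 = if W s xs j is _.+1 then W s xs j else
    if S [:: s, j & xs] is v.+1 then (if v is _.+1 then 0 else j.+2) else 1.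
  by [].
(* A value [1] of [S] means that the test found [0]; a larger one, that it found a nonzero value. *)
have WP s xs j :
  (W s xs j = 0 <-> forall i, i < j -> 1 < S [:: s, i & xs]) /\
  (forall y, W s xs j = y.+2 <->
     [/\ y < j, S [:: s, y & xs] = 1 & forall i, i < y -> 1 < S [:: s, i & xs]]).
  elim: j => [|j [IH0 IH1]]; first by split=> [|y]; split=> // -[].
  rewrite WS; case E: (W s xs j) => [|[|w]].
  - have {}IH0 := IH0.1 E.
    case ES: (S _) => [|[|v]].
    + split=> [|y]; split=> //; first by move=> /(_ j (ltnSn _)); rewrite ES.
      move=> [+ S1 Slt]; rewrite ltnS leq_eqVlt => /orP[/eqP yj|yj].
        by move: S1; rewrite yj ES.
      by have := IH0 _ yj; rewrite S1.
    + split=> [|y]; split=> //; first by move=> /(_ j (ltnSn _)); rewrite ES.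
        by move=> [<-].
      move=> [+ S1 Slt]; rewrite ltnS leq_eqVlt => /orP[/eqP -> //|yj].
      by have := IH0 _ yj; rewrite S1.
    + split=> [|y]; split=> //.
        move=> _ i; rewrite ltnS leq_eqVlt => /orP[/eqP ->|/IH0 //].
        by rewrite ES.
      move=> [+ S1 Slt]; rewrite ltnS leq_eqVlt => /orP[/eqP yj|yj].
        by move: S1; rewrite yj ES.
      by have := IH0 _ yj; rewrite S1.
  - split=> [|y]; split=> //.
      move=> H; suff: W s xs j = 0 by rewrite E.
      by apply/IH0 => i ij; apply: H; rewrite ltnW.
    move=> [+ S1 Slt]; rewrite ltnS leq_eqVlt => /orP[/eqP yj|yj].
      suff: W s xs j = 0 by rewrite E.
      by apply/IH0; rewrite -yj.
    by have/IH1 : [/\ y < j, S [:: s, y & xs] = 1 &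
        forall i, i < y -> 1 < S [:: s, i & xs]] by []; rewrite E.
  - have [wj Sw Slw] := (IH1 w).1 E.
    split=> [|y]; split=> //.
    + by move=> /(_ w (leqW wj)); rewrite Sw.
    + by move=> [<-]; split=> //; apply: leqW.
    + move=> [_ S1 Slt]; congr _.+2.
      by case: (ltngtP w y) => // [/Slt|/Slw]; rewrite ?S1 ?Sw.
have TP s xs y : T (s :: xs) = y.+1 <->
     [/\ y < s, S [:: s, y & xs] = 1 & forall i, i < y -> 1 < S [:: s, i & xs]].
  rewrite -((WP s xs s).2 y) /T /= drop0.
  by case: (W s xs s) => [|[|w]] //; split=> [[->]|[->]].
have S2 s i xs : 1 < S [:: s, i & xs] <-> exists z, S [:: s, i & xs] = z.+2.
  by case: (S _) => [|[|w]]; split=> //; [case | case | exists w].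
exists T; split.
- apply: totrec_pred.
  pose H ys := if nth 0 ys 1 is _.+1 then nth 0 ys 1 else
    if S [:: nth 0 ys 2, nth 0 ys 0 & drop 3 ys] is v.+1 then
    (if v is _.+1 then 0 else (nth 0 ys 0).+2) else 1.
  have HP : totrec n.+3 H.
    apply: (@totrec_case _ _ _ (fun zs => nth 0 zs 2)); first exact: totrec_nth.
      apply: (@totrec_case _ _ _
        (fun zs => if nth 0 zs 0 is _.+1 then 0 else (nth 0 zs 1).+2)).
      - apply: (totrec_subst Sc); do 2 (apply: totrecs_cons; first exact: totrec_nth).
        exact: (totrecs_drop 3 n).
      - exact: totrec_const.
      - apply: (@totrec_case _ _ _ (fun=> 0)); first exact: totrec_nth.
          by do 2 apply: totrec_succ; apply: totrec_nth.
        exact: totrec_const.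
    exact: totrec_nth.
  apply: eq_totrec (totrec_iteri (totrec_nth _ 0) (totrec_const _ 0) HP) => ys _.
  by case: ys => [|s [|d ys]].
- move=> s t xs y sx st /TP [ys S1 Slt]; apply/TP; split.
  + exact: leq_trans st.
  + by apply: Sm S1; rewrite //= sx.
  + move=> i /Slt /S2 [z E]; apply/S2; exists z; apply: Sm E => //=.
    by rewrite sx.
- move=> xs y /=; split=> [[/SP [s Es] yP]|[s /TP [_ S1 Slt]]].
    have /choice [p pP] (i : 'I_y) : exists s, 1 < S [:: s, i : nat & xs].
      by have [z /SP[t Et]] := yP _ (ltn_ord i); exists t; apply/S2; exists z.
    exists (maxn (maxn s (\max_i p i)) y.+1); apply/TP; split.
    + by rewrite leq_max leqnn orbT.
    + by apply: Sm Es; rewrite /= ?size_tuple // -maxnA leq_maxl.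
    + move=> i iy; have /S2 [z E] := pP (Ordinal iy); apply/S2; exists z.
      apply: Sm E; rewrite /= ?size_tuple // !leq_max.
      by rewrite (leq_bigmax (Ordinal iy)) orbT.
  split; first by apply/SP; exists s.
  by move=> i /Slt /S2 [z E]; exists z; apply/SP; exists s.
Qed.

Lemma stages_exist n (c : murec n) : exists T, stages c T.
Proof.
have simple m (d : murec m) F : totrec m F ->
    (forall (xs : m.-tuple nat) y, meval d xs y <-> y = F xs) -> exists T, stages d T.
  move=> Fc dP; exists (fun ys => (F (drop 1 ys)).+1); split.
  - by apply: totrec_succ; apply: (totrec_wk 1 Fc).
  - by move=> s t xs y _ _ /=; rewrite !drop0.
  - move=> xs y; rewrite dP /=; rewrite drop0.
    by split=> [->|[_ [->]]] //; exists 0.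
elim: c => {n} [n||n i|m n g [S SP] h hP|n g [S SP] h [U UP]|n g [S SP]].
- exact: (simple _ _ (fun=> 0) (totrec_const _ 0)).
- apply: (simple _ _ (fun xs => (nth 0 xs 0).+1)).
    by apply: totrec_succ; apply: totrec_nth.
  by move=> xs y /=; rewrite /thead (tnth_nth 0).
- apply: (simple _ _ (nth 0 ^~ i) (totrec_nth _ i)) => xs y /=.
  by rewrite (tnth_nth 0).
- by have [U UP] := choice hP; apply: stages_comp SP UP.
- exact: stages_prec SP UP.
- exact: stages_min SP.
Qed.

(** Values found at stages [s] and [t] both persist at stage [maxn s t]. *)
Lemma meval_fun n (c : murec n) xs y z : meval c xs y -> meval c xs z -> y = z.
Proof.
have [T [_ Tm TP]] := stages_exist c.
move=> /TP [s Es] /TP [t Et]; apply: succn_inj.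
by rewrite -(Tm _ _ _ _ _ (leq_maxl s t) Es)
  ?(Tm _ _ _ _ _ (leq_maxr s t) Et) ?size_tuple.
Qed.

(** * Effective search and semidecidable predicates *)

(* Dovetailing: search first for a bound [s] on both the stage and the witness. *)
Lemma computable_selection R :
  partrec 2 R -> (forall b, exists e, R [:: b; e] 0) ->
  exists2 h, computable h & forall b, R [:: b; h b] 0.
Proof.
move=> [c cP] Rex; have [T [Tc Tm TP]] := stages_exist c.
have RT b e : R [:: b; e] 0 <-> exists s, T [:: s; b; e] = 1.
  by rewrite -(TP [tuple b; e]) cP.
(* The distance from [T ys] to [1], the code of the value [0]. *)
pose D ys := (T ys - 1) + (1 - T ys).
have D0 ys : D ys = 0 <-> T ys = 1 by rewrite /D; case: (T ys) => [|[|t]].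
have Dc : totrec 3 D.
  by apply: totrec_add; apply: totrec_sub => //; apply: totrec_const.
(* The loop starts at [1], for no witness yet, and keeps [0] once a witness below the bound
   appears. *)
pose P ys := iteri (nth 0 ys 0)
  (fun e z => if z is _.+1 then D [:: nth 0 ys 0; nth 0 ys 1; e] else 0) 1.
have Pc : totrec 2 P.
  apply: (@totrec_iteri 2 _ (fun=> 1) (fun zs => if nth 0 zs 1 is _.+1 then
      D [:: nth 0 zs 2; nth 0 zs 3; nth 0 zs 0] else 0)).
  - exact: totrec_nth.
  - exact: totrec_const.
  apply: (@totrec_case 4 _ (fun=> 0)
    (fun zs => D [:: nth 0 zs 3; nth 0 zs 4; nth 0 zs 1])).
  - exact: totrec_nth.
  - exact: totrec_const.
  apply: (totrec_subst Dc).
  do 3 (apply: totrecs_cons; first exact: totrec_nth).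
  exact: totrecs_nil.
have P0 s b : P [:: s; b] = 0 <-> exists2 e, e < s & D [:: s; b; e] = 0.
  rewrite /P /=; move: {1 3}s => m; elim: m => [|m IH] /=; first by split=> // -[].
  case E: (iteri m _ _) => [|z].
    by split=> // _; have [e em De] := IH.1 E; exists e => //; apply: leqW.
  split=> [De|[e]]; first by exists m.
  rewrite ltnS leq_eqVlt => /orP[/eqP -> //|em De].
  by have := IH.2 (ex_intro2 _ _ e em De); rewrite E.
have [[|b []] // _|t tc tP] := totrec_mu Pc.
  have [e /RT [s Ts]] := Rex b.
  exists (maxn s e.+1); apply/P0; exists e; first by rewrite leq_max leqnn orbT.
  by apply/D0; apply: Tm Ts; rewrite // leq_maxl.
(* With the stage fixed by the first search, a second minimization finds the witness itself. *)
have Fc : totrec 2 (fun ys => D [:: t (drop 1 ys); nth 0 ys 1; nth 0 ys 0]).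
  apply: (totrec_subst Dc); apply: totrecs_cons; first exact: (totrec_wk 1 tc).
  do 2 (apply: totrecs_cons; first exact: totrec_nth).
  exact: totrecs_nil.
have [[|b []] // _|h hc hP] := totrec_mu Fc.
  by have /P0 [e _ De] := tP [:: b] erefl; exists e.
exists (fun b => h [:: b]) => [|b].
  by have [d dP] := hc; exists d => x; apply/dP.
by apply/RT; exists (t [:: b]); apply/D0; apply: (hP [:: b]).
Qed.

(** Acceptance is halting with value [0], the form that [computable_selection] searches for;
    divergence and other values both reject. *)
Definition semidec n (A : seq nat -> Prop) : Prop :=
  exists2 R, partrec n R & forall xs, size xs = n -> R xs 0 <-> A xs.

Lemma semidec_eq0 n F : totrec n F -> semidec n (fun xs => F xs = 0).
Proof. by move=> Fc; exists (fun xs y => y = F xs) => // xs _; split=> ->. Qed.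

Lemma semidec_value n R a : partrec n R -> semidec n (R^~ a).
Proof.
move=> Rc; exists (fun xs y => exists2 z, R xs z & y = (z - a) + (a - z)).
  have Dc : totrec n.+1 (fun zs => (nth 0 zs 0 - a) + (a - nth 0 zs 0)).
    apply: totrec_add; apply: totrec_sub;
      solve [exact: totrec_nth | exact: totrec_const].
  exact: partrec_bind Rc Dc.
move=> xs _; split=> [[z Rz /esym/eqP]|Ra]; last by exists a; rewrite ?subnn.
by rewrite addn_eq0 !subn_eq0 -eqn_leq => /eqP <-.
Qed.

(** A sum vanishes only if both summands do, and it diverges if either does. *)
Lemma semidec_and n A B :
  semidec n A -> semidec n B -> semidec n (fun xs => A xs /\ B xs).
Proof.
move=> [R Rc RA] [S Sc SB].
exists (fun xs y => exists2 z, R xs z & exists2 w, S xs w & y = z + w).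
  have S1c : partrec n.+1 (fun ys => S (drop 1 ys)).
    exact: (partrec_subst Sc (totrecs_drop 1 n)).
  have addc : totrec n.+2 (fun zs => nth 0 zs 1 + nth 0 zs 0).
    by apply: totrec_add; apply: totrec_nth.
  apply: eq_partrec (partrec_bind Rc (partrec_bind S1c addc)) => xs y _ /=.
  by rewrite drop0.
move=> xs sx; split=> [[z Rz [w Sw /esym/eqP]]|[/(RA _ sx) R0 /(SB _ sx) S0]].
  rewrite addn_eq0 => /andP[/eqP z0 /eqP w0]; rewrite z0 w0 in Rz Sw.
  by split; [apply/RA | apply/SB].
by exists 0; [exact: R0 | exists 0; first exact: S0].
Qed.

(** [computable] asks that the right value be obtained; that no other value is obtained comes from
    [meval_fun]. *)
Lemma computableP f : computable f <-> totrec 1 (fun xs => f (nth 0 xs 0)).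
Proof.
split=> [[c cP]|[c cP]]; exists c; last by move=> x; apply/cP.
move=> xs y; case/tupleP: xs => x xs; rewrite (tuple0 xs) /=.
by split=> [/(meval_fun (cP x)) -> //|->]; apply: cP.
Qed.

(** * Numberings and finite initial segments *)

Lemma numbering_partrec (phi : numbering) :
  partrec 2 (fun xs y => phi (nth 0 xs 0) (nth 0 xs 1) = Some y).
Proof.
have [c cP] := numbering_partial_recursive phi; exists c => xs y.
by case/tupleP: xs => e xs; case/tupleP: xs => x xs; rewrite (tuple0 xs) cP.
Qed.

Lemma numbering_of_partrec (U : nat -> nat -> option nat) :
  partrec 2 (fun xs y => U (nth 0 xs 0) (nth 0 xs 1) = Some y) ->
  exists psi : numbering, forall e, psi e = U e.
Proof.
move=> [c cP].
have Up : partial_recursive2 U by exists c => e x y; rewrite cP.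
by exists (Numbering Up).
Qed.

Definition extends (phi : numbering) (sigma : seq nat) (e : nat) : Prop :=
  forall x, x < size sigma -> phi e x = Some (nth 0 sigma x).

Lemma extends_cat (phi : numbering) sigma tau e :
  extends phi (sigma ++ tau) e -> extends phi sigma e.
Proof.
move=> st x xs; rewrite st ?size_cat ?ltn_addr //.
by rewrite nth_cat xs.
Qed.

Lemma extends_rcons (phi : numbering) sigma a e :
  extends phi (rcons sigma a) e <->
  extends phi sigma e /\ phi e (size sigma) = Some a.
Proof.
split=> [se|[se sa] x]; last first.
  rewrite size_rcons nth_rcons ltnS leq_eqVlt => /orP[/eqP ->|xs].
    by rewrite ltnn eqxx.
  by rewrite xs se.
split; first by apply: (@extends_cat _ _ [:: a]); rewrite cats1.
by rewrite se ?size_rcons // nth_rcons ltnn eqxx.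
Qed.

Lemma semidec_extends (phi : numbering) n i sigma :
  semidec n (fun xs => extends phi sigma (nth 0 xs i)).
Proof.
elim/last_ind: sigma => [|sigma a [R Rc RP]].
  have [R Rc RP] := semidec_eq0 (totrec_const n 0).
  by exists R => // xs /RP ->.
have phic : partrec n (fun xs y => phi (nth 0 xs i) (size sigma) = Some y).
  apply: (partrec_subst (G := fun xs => [:: nth 0 xs i; size sigma])
    (numbering_partrec phi)).
  apply: totrecs_cons; first exact: totrec_nth.
  by apply: totrecs_cons (totrec_const _ _) (totrecs_nil _).
have [S Sc SP] := semidec_and (ex_intro2 _ _ R Rc RP) (semidec_value a phic).
by exists S => // xs /SP ->; rewrite extends_rcons.
Qed.

(** Diagonalization: entry [j] of [tau] differs from the value of [phi j] at its position, and it is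
    defined even where [phi j] is not. *)
Lemma extends_escape (phi : numbering) sigma b :
  exists tau, forall e, extends phi (sigma ++ tau) e ->
    forall j, j <= b -> ~ phi j =1 phi e.
Proof.
pose a j := if phi j (size sigma + j) is Some 0 then 1 else 0.
exists (mkseq a b.+1) => e se j jb jE.
have := se (size sigma + j).
rewrite size_cat size_mkseq ltn_add2l ltnS jb nth_cat ltnNge leq_addr /=.
rewrite addKn nth_mkseq ?ltnS // -jE /a => /(_ erefl).
by case: (phi j _) => [[]|].
Qed.

(** * Consequences of computable boundedness *)

Lemma computable_has_index (phi : numbering) g :
  computably_bounded phi -> computable g -> exists e, phi e =1 Some \o g.
Proof.
move=> phi_bounded /computableP gc.
(* Boundedness is applied to the numbering whose members all equal [g]. *)
have [psi psiE] : exists psi : numbering, forall e, psi e = Some \o g.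
  apply: numbering_of_partrec.
  have [c cP] := totrec_subst gc (totrecs_drop 1 1).
  exists c => xs y; rewrite cP /= nth_drop addn0.
  by split=> [->|[->]].
by have [f _ /(_ 0) [j _ jE]] := phi_bounded psi; exists j => x; rewrite jE psiE.
Qed.

Lemma extends_inhabited (phi : numbering) sigma :
  computably_bounded phi -> exists e, extends phi sigma e.
Proof.
move=> phi_bounded.
(* [sigma] continued by zeros is a finite table lookup, hence computable. *)
have [|e eE] := @computable_has_index _ (nth 0 sigma) phi_bounded.
  by apply/computableP/totrec_lookup/totrec_nth.
by exists e => x _; rewrite eE.
Qed.

Lemma min_index_not_above (phi : numbering) h :
  computably_bounded phi -> computable h -> ~ forall b, b < min_index phi (h b).
Proof.
move=> phi_bounded /computableP hc hP.
pose U e x := if phi e e is Some b then phi (h b) x else None.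
have [psi psiE] : exists psi : numbering, forall e, psi e = U e.
  apply: numbering_of_partrec.
  have selfc : partrec 2 (fun xs y => phi (nth 0 xs 0) (nth 0 xs 0) = Some y).
    apply: (partrec_subst (G := fun xs => [:: nth 0 xs 0; nth 0 xs 0])
    (numbering_partrec phi)).
    by do 2 (apply: totrecs_cons; first exact: totrec_nth); apply: totrecs_nil.
  have hphic : partrec 3 (fun xs y => phi (h (nth 0 xs 0)) (nth 0 xs 2) = Some y).
    apply: (partrec_subst (G := fun xs => [:: h (nth 0 xs 0); nth 0 xs 2])
    (numbering_partrec phi)).
    apply: totrecs_cons.
      apply: (totrec_subst (G := fun xs => [:: nth 0 xs 0]) hc).
      exact: totrecs_cons (totrec_nth _ 0) (totrecs_nil _).
    exact: totrecs_cons (totrec_nth _ 2) (totrecs_nil _).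
  apply: eq_partrec (partrec_bind selfc hphic) => xs y _ /=; rewrite /U.
  case: (phi _ _) => [b|]; last by split=> [[]|].
  by split=> [[z [->]]|] //; exists b.
have [g gc gP] := phi_bounded psi.
(* As [phi c c] is [g c], [psi c] is [phi (h (g c))]; the bound gives it an index [j <= g c], below
   its minimal index. *)
have [c cE] := computable_has_index phi_bounded gc.
have [j jg jE] := gP c.
have [minM minE] := min_indexP phi (h (g c)).
apply: (minM j); first exact: leq_ltn_trans (hP _).
by move=> x; rewrite minE jE psiE /U cE.
Qed.

Theorem theorem4p3 (phi : numbering) (k : nat) :
  computably_bounded phi -> 0 < k ->
  ~ exists f : nat -> k.-tuple nat,
      computable_tuple f /\ forall e : nat, min_index phi e \in f e.
Proof.
move=> phi_bounded _ [f [fc fP]].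
pose small b e := count (fun a => a <= b) (f e).
have escape sigma b : exists tau, forall e,
    extends phi (sigma ++ tau) e -> b < min_index phi e.
  have [tau tauP] := extends_escape phi sigma b.
  exists tau => e /tauP eE; rewrite ltnNge; apply/negP => /eE; apply.
  by case: (min_indexP phi e).
have crowd r : exists sigma b, forall e,
    extends phi sigma e -> r <= small b e /\ b < min_index phi e.
  elim: r => [|r [sigma [b0 IH]]].
    have [tau tauP] := escape [::] 0.
    by exists tau, 0 => e /tauP.
  have [[b bP]|nob] :=
      pselect (exists b, forall e, extends phi sigma e -> r < small b e).
    have [tau tauP] := escape sigma b.
    exists (sigma ++ tau), b => e se; split; last exact: tauP.
    exact: bP (extends_cat se).
  have smallc : totrec 2 (fun xs => small (nth 0 xs 0) (nth 0 xs 1) - r).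
    apply: totrec_sub (totrec_const _ _).
    (* With truncated subtraction, [1 - (a - b)] is the indicator of [a <= b]. *)
    apply: (@eq_totrec _ (fun xs => \sum_(i <- enum 'I_k)
       (1 - (tnth (f (nth 0 xs 1)) i - nth 0 xs 0)))).
      move=> xs _; rewrite /small big_enum -sum1_count [RHS]big_mkcond /=.
      rewrite [RHS]big_tuple; apply: eq_big => // i _.
      by rewrite -subn_eq0; case: (tnth _ _ - _).
    apply: totrec_sum => i; apply: totrec_sub; first exact: totrec_const.
    apply: totrec_sub; last exact: totrec_nth.
    move/computableP: (fc i) => fic.
    apply: (totrec_subst (G := fun xs => [:: nth 0 xs 1]) fic).
    exact: totrecs_cons (totrec_nth _ 1) (totrecs_nil _).
  have [R Rc RP] := semidec_and (semidec_extends phi 2 1 sigma) (semidec_eq0 smallc).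
  have [b|h hc hP] := computable_selection Rc.
    apply: contrapT => noe; apply: nob; exists b => e se; rewrite ltnNge; apply/negP.
    by move=> er; apply: noe; exists e; apply/RP => //; split=> //; apply/eqP.
  case: (min_index_not_above phi_bounded hc) => b.
  have /RP [//|/= se /eqP] := hP b; rewrite subn_eq0 => le_r.
  have [ge_r ltm] := IH _ se.
  set m := min_index phi (h b) in ltm *.
  rewrite ltnNge; apply/negP => mb.
  (* [m] is an entry of [f (h b)] in [(b0, b]], where there is none left. *)
  have : small b0 (h b) + count (pred1 m) (f (h b)) <= small b (h b).
    (* The intersection term is zero because [b0 < m]; the union lies below [b]. *)
    rewrite /small -count_predUI -[X in _ <= X]addn0; apply: leq_add.
      apply: sub_count => a /orP[/= ab|/eqP -> //].
      by apply: leq_trans ab (leq_trans _ mb); apply: ltnW.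
    rewrite leqn0 -(count_pred0 (f (h b))); apply/eqP/eq_count => a /=.
    by apply/negP => /andP[ab /eqP am]; rewrite am leqNgt ltm in ab.
  have m1 : 0 < count (pred1 m) (f (h b)) by rewrite -has_count has_pred1 fP.
  (* The chain of inequalities reads [r + 1 <= r]. *)
  move=> le_count; have := leq_trans (leq_add ge_r m1) (leq_trans le_count le_r).
  by rewrite addn1 ltnn.
have [sigma [b sb]] := crowd k.
have [e /sb [kb mb]] := extends_inhabited sigma phi_bounded.
(* All [k] entries are at most [b], yet the entry [min_index phi e] exceeds [b]. *)
have : all (fun a => a <= b) (f e).
  by rewrite all_count eqn_leq count_size size_tuple kb.
by move=> /allP /(_ _ (fP e)); rewrite leqNgt mb.
Qed.
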